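(* Let $q$ be a prime power and $n\ge 2$ an integer. Let $C=\{\mathcal A_1,\ldots,\mathcal A_n\}$ be a set of $\mathbb F_q$-affine hyperplanes of $\mathbb F_{q^n}$ in general position, and let $\chi$ be a nontrivial multiplicative character of $\mathbb F_{q^n}$. Let $\mathcal S_C^*=\bigcap_{i=1}^n\left(\mathbb F_{q^n}\setminus\mathcal A_i\right)$ and $\delta(q,n)=\sum_{i=0}^{n-1}\binom{n}{i}q^{\min\{i,\,n/2\}}$. Then $$\left|\sum_{y\in\mathcal S_C^*}\chi(y)\right|\le \delta(q,n)\le (2^n-1)q^{n/2}.$$
   Context: $\mathbb F_{q^n}$ is regarded as an $n$-dimensional vector space over $\mathbb F_q$. An $\mathbb F_q$-affine space of dimension $t$ is a set $u+V$ with $u\in\mathbb F_{q^n}$ and $V$ an $\mathbb F_q$-linear subspace of dimension $t$; an $\mathbb F_q$-affine hyperplane has dimension $n-1$. The set $C$ is in general position if for each $1\le k\le n$ the intersection of any $k$ distinct elements of $C$ is an $\mathbb F_q$-affine space of dimension $n-k$. A multiplicative character is a group homomorphism $\mathbb F_{q^n}^*\to\mathbb C^*$, extended by $\chi(0)=0$; it is trivial if it is identically $1$ on $\mathbb F_{q^n}^*$. *)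

(* Defs.v *)
From HB Require Import structures.
From mathcomp Require Import all_boot all_order all_algebra all_field.
From mathcomp Require Import complex reals exp.

Set Implicit Arguments.
Unset Strict Implicit.
Unset Printing Implicit Defensive.

Import Order.TTheory GRing.Theory Num.Theory.
Local Open Scope ring_scope.
Local Open Scope complex_scope.

(* [finvect_type L] is [L] itself, carrying both its structure of extension of
   the finite field [F] and a finite field structure, so that [{set _}] and
   finite sums over its elements make sense. *)

Definition affine_space (F : finFieldType) (L : fieldExtType F) (t : nat)
    (A : {set finvect_type L}) : Prop :=
  exists (u : finvect_type L) (V : {vspace finvect_type L}),
    \dim V = t /\ A = [set u + v | v in V].

Definition affine_hyperplane (F : finFieldType) (L : fieldExtType F)
    (A : {set finvect_type L}) : Prop :=
  affine_space (\dim {:L}).-1 A.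

Definition general_position (F : finFieldType) (L : fieldExtType F)
    (C : {set {set finvect_type L}}) : Prop :=
  forall (k : nat) (D : {set {set finvect_type L}}),
    (1 <= k <= \dim {:L})%N -> D \subset C -> #|D| = k ->
    affine_space (\dim {:L} - k)%N (\bigcap_(A in D) A).

Definition multiplicative_character (R : realType) (K : fieldType)
    (chi : K -> R[i]) : Prop :=
  [/\ chi 0 = 0,
      forall x, x != 0 -> chi x != 0
    & forall x y, x != 0 -> y != 0 -> chi (x * y) = chi x * chi y].

Definition trivial_character (R : realType) (K : fieldType)
    (chi : K -> R[i]) : Prop :=
  forall x, x != 0 -> chi x = 1.

Definition complement_points (F : finFieldType) (L : fieldExtType F)
    (C : {set {set finvect_type L}}) : {set finvect_type L} :=
  \bigcap_(A in C) ~: A.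

Definition delta (R : realType) (q n : nat) : R :=
  \sum_(0 <= i < n) 'C(n, i)%:R * q%:R `^ Num.min i%:R (n%:R / 2).

(* Main.v *)
(* Inclusion-exclusion writes the sum over the complement as a signed sum of
   character sums over the affine spaces cut out by the nonempty subsets of C
   (the empty subset contributes the full sum, which is 0).  A character sum
   over u + V with #|V| = q^t is trivially at most q^t.  The bound q^(n/2) comes
   from a second moment, without Gauss sums: h(w) = sum_(v in V) chi(w + v)
   satisfies sum_w |h(w)|^2 = q^t (q^n - q^t), and h is constant on the q^t
   elements of u + V, so |h(u)|^2 <= q^n - q^t. *)

Require Import Defs.
From HB Require Import structures.
From mathcomp Require Import all_boot all_order all_algebra all_field.
From mathcomp Require Import complex reals exp.

Import Order.TTheory GRing.Theory Num.Theory.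
Local Open Scope ring_scope.
Local Open Scope complex_scope.

(** * Inclusion-exclusion for weighted sums *)

Lemma sum_inclusion_exclusion (R : comPzRingType) (T : finType)
    (C : {set {set T}}) (f : T -> R) :
  \sum_(y in \bigcap_(A in C) ~: A) f y =
  \sum_(D : {set {set T}} | D \subset C)
    (-1) ^+ #|D| * \sum_(y in \bigcap_(A in D) A) f y.
Proof.
have indicator (y : T) : (y \in \bigcap_(A in C) ~: A)%:R =
    \sum_(D : {set {set T}} | D \subset C)
      (-1) ^+ #|D| * (y \in \bigcap_(A in D) A)%:R :> R.
  (* The indicator of the complement is the product of [1 - (y \in A)] over [C]. Setting [F] to 0
     off [C] lets the product run over all sets; once it is expanded, every [D] not contained in [C]
     contributes 0. *)
  pose F (A : {set T}) : R := if A \in C then - (y \in A)%:R else 0.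
  transitivity (\prod_A (F A + 1)).
    have [yC|yC] := boolP (y \in _).
      rewrite big1 // => A _; rewrite /F; case: ifP => [AC|_]; last exact: add0r.
      move/bigcapP: yC => /(_ A AC); rewrite inE => /negPf ->.
      by rewrite oppr0 add0r.
    have /existsP[A /andP[AC yA]] : [exists A, (A \in C) && (y \in A)].
      apply: contraR yC => /existsPn noA; apply/bigcapP => A AC; rewrite inE.
      by have := noA A; rewrite AC.
    by rewrite (bigD1 A) //= /F AC yA addNr mul0r.
  rewrite bigA_distr [RHS]big_mkcond /=; apply: eq_bigr => D _.
  rewrite -big_mkcond /=.
  case: ifPn => [DC|/subsetPn[A AD AC]]; last first.
    by rewrite (bigD1 A) //= /F (negPf AC) mul0r.
  have FD A : A \in D -> F A = - (y \in A)%:R.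
    by move=> AD; rewrite /F (subsetP DC).
  rewrite (eq_bigr _ FD).
  have [yD|yD] := boolP (y \in _).
    rewrite mulr1 -prodr_const; apply: eq_bigr => A AD.
    by rewrite (bigcapP yD).
  have /existsP[A /andP[AD yA]] : [exists A, (A \in D) && (y \notin A)].
    apply: contraR yD => /existsPn noA; apply/bigcapP => A AD.
    by have := noA A; rewrite AD negbK.
  by rewrite mulr0 (bigD1 A) //= (negPf yA) oppr0 mul0r.
rewrite big_mkcond /=.
under eq_bigr => y _ do rewrite -mulrb -mulr_natl indicator mulr_suml.
rewrite exchange_big; apply: eq_bigr => D _ /=.
rewrite big_distrr /= [RHS]big_mkcond /=; apply: eq_bigr => y _.
by rewrite -mulrA mulr_natl mulrb; case: ifP; rewrite ?mulr0.
Qed.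

(** * Multiplicative characters of a finite field *)

Section Character.

Variables (R : realType) (K : finFieldType) (chi : K -> R[i]).
Hypothesis chi_char : multiplicative_character chi.

Lemma character0 : chi 0 = 0.
Proof. by case: chi_char. Qed.

Lemma characterM x y : chi (x * y) = chi x * chi y.
Proof.
case: chi_char => c0 _ cM.
have [->|x0] := eqVneq x 0; first by rewrite !mul0r c0 mul0r.
by have [->|y0] := eqVneq y 0; [rewrite !mulr0 c0 mulr0 | exact: cM].
Qed.

Lemma character1 : chi 1 = 1.
Proof.
case: chi_char => _ cN0 _; have c1 := cN0 _ (oner_neq0 _).
by apply: (mulfI c1); rewrite -characterM !mulr1.
Qed.

Lemma characterX x n : chi (x ^+ n) = chi x ^+ n.
Proof.
by elim: n => [|n IHn]; rewrite ?expr0 ?character1 // !exprS characterM IHn.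
Qed.

(** The unit group is finite, so [chi x] is a root of unity. *)
Lemma norm_character x : x != 0 -> `|chi x| = 1.
Proof.
move=> x0; have cx0 : chi x != 0 by case: chi_char => _ /(_ _ x0).
have card_gt0 : (0 < #|K|.-1)%N by rewrite -subn1 subn_gt0 finNzRing_gt1.
apply/eqP; rewrite -(pexpr_eq1 card_gt0) // -normrX; apply/eqP.
suff -> : chi x ^+ #|K|.-1 = 1 by rewrite normr1.
apply: (mulfI cx0); rewrite -exprS prednK ?(ltnW (finNzRing_gt1 K)) //.
by rewrite -characterX expf_card mulr1.
Qed.

Lemma normC_character x : chi x * (chi x)^*%R = (x != 0)%:R.
Proof.
rewrite -normCK; have [->|x0] := eqVneq x 0.
  by rewrite character0 normr0 expr0n.
by rewrite norm_character // expr1n.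
Qed.

(** The convention [0^-1 = 0] covers [x = 0] as well, so a product with a conjugate is always a
    single value of [chi]. *)
Lemma conj_character x : (chi x)^*%R = chi x^-1.
Proof.
have [->|x0] := eqVneq x 0; first by rewrite invr0 character0 conjC0.
have cx0 : chi x != 0 by case: chi_char => _ /(_ _ x0).
by apply: (mulfI cx0); rewrite normC_character x0 -characterM mulfV // character1.
Qed.

Hypothesis chi_nontrivial : ~ trivial_character chi.

Lemma sum_character : \sum_x chi x = 0.
Proof.
have /existsP[a /andP[a0 ca]] : [exists a, (a != 0) && (chi a != 1)].
  apply: contra_notT chi_nontrivial => /existsPn triv x x0.
  by have := triv x; rewrite x0 /= negbK => /eqP.
(* Multiplication by [a] permutes the field, and [chi a != 1] then forces the sum to vanish. *)
have : \sum_x chi x = chi a * \sum_x chi x.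
  rewrite {1}(reindex_inj (mulfI a0)) big_distrr /=.
  by apply: eq_bigr => x _; rewrite characterM.
move/eqP; rewrite -{1}[\sum_x _]mul1r -subr_eq0 -mulrBl mulf_eq0 subr_eq0.
by rewrite eq_sym (negPf ca) => /eqP.
Qed.

(* For [z != 0] the summand is [chi (1 + c / z)], and [z |-> 1 + c / z] is a
   permutation of [K] once [0^-1 = 0]; only the term [chi 1] at [z = 0] is
   missing from the full character sum. *)
Lemma autocorrelation_character (a b : K) : a != b ->
  \sum_w chi (w + a) * (chi (w + b))^*%R = -1.
Proof.
move=> ab; set c := a - b; have c0 : c != 0 by rewrite subr_eq0.
rewrite (reindex_inj (addIr (- b))) /=.
transitivity (\sum_z (chi (1 + c * z^-1) - (z == 0)%:R)).
  apply: eq_bigr => z _; rewrite subrK conj_character -characterM.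
  rewrite -addrA [- b + a]addrC -/c.
  have [->|z0] := eqVneq z 0.
    by rewrite invr0 !mulr0 addr0 character0 character1 subrr.
  by rewrite subr0 mulrDl mulfV.
have inj : injective (fun z : K => 1 + c * z^-1).
  by move=> x y /addrI /(mulfI c0) /invr_inj.
rewrite sumrB -(reindex_inj inj (P := xpredT) (F := chi)) sum_character sub0r.
congr (- _).
by rewrite (bigD1 0) //= eqxx big1 ?addr0 // => z /negPf ->.
Qed.

(** Expanding the square gives one autocorrelation for each pair in [A]: [#|K| - 1] on the diagonal,
    where only the zero of [chi] is lost, and [-1] off it. *)
Lemma character_energy (A : {set K}) :
  \sum_w `|\sum_(v in A) chi (w + v)| ^+ 2 = #|A|%:R * (#|K|%:R - #|A|%:R).
Proof.
have corr a b : \sum_w chi (w + a) * (chi (w + b))^*%R =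
    #|K|%:R * (a == b)%:R - 1.
  have [<-|ab] := eqVneq a b; last first.
    by rewrite autocorrelation_character // mulr0 sub0r.
  rewrite (reindex_inj (addIr (- a))) /=.
  under eq_bigr => z _ do rewrite subrK normC_character.
  rewrite mulr1 (bigD1 0) //= eqxx add0r (eq_bigr (fun=> 1)) => [|z ->] //.
  by rewrite sumr_const cardC1 -subn1 natrB // ltnW // finNzRing_gt1.
under eq_bigr => w _.
  rewrite normCK rmorph_sum /= big_distrlr /=. over.
rewrite exchange_big /=; under eq_bigr => a _ do rewrite exchange_big /=.
transitivity (\sum_(a in A) (#|K|%:R - #|A|%:R : R[i])); last first.
  by rewrite sumr_const mulr_natl.
apply: eq_bigr => a aA; under eq_bigr => b _ do rewrite corr.
rewrite sumrB sumr_const; congr (_ - _).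
rewrite -big_distrr /= (bigD1 a) //= eqxx big1 ?addr0 ?mulr1 // => b.
by rewrite eq_sym => /andP[_ /negPf ->].
Qed.

End Character.

(** * Character sums over affine spaces *)

Lemma norm_sum_coset_character (R : realType) (F : finFieldType)
    (L : fieldExtType F) (chi : finvect_type L -> R[i])
    (u : finvect_type L) (V : {vspace finvect_type L}) :
  multiplicative_character chi -> ~ trivial_character chi ->
  `|\sum_(v in V) chi (u + v)| ^+ 2 <= #|finvect_type L|%:R.
Proof.
move=> chi_char chi_nontriv.
set h := fun w => \sum_(v in V) chi (w + v).
have h_coset v0 : v0 \in V -> h (u + v0) = h u.
  move=> v0V; rewrite /h [RHS](reindex_inj (addrI v0)) /=.
  by apply: eq_big => [v|v _]; rewrite ?addrA // rpredDl.
have V_gt0 : (0 < #|V|)%N by apply/card_gt0P; exists 0; rewrite mem0v.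
have : `|h u| ^+ 2 *+ #|V| <= #|V|%:R * (#|finvect_type L|%:R - #|V|%:R).
  have := character_energy _ _ chi chi_char chi_nontriv [set v in V].
  rewrite cardsE => <-.
  under [leRHS]eq_bigr => w _ do under eq_bigl => v do rewrite inE.
  rewrite -/h [leRHS](reindex_inj (addrI u)) /= -sumr_const.
  (* After the shift by [u], the terms indexed by [V] all equal [|h u|^2]; the remaining ones are
     nonnegative and are dropped. *)
  rewrite [leRHS](bigID [in V]) /=.
  rewrite (eq_bigr (fun v => `|h (u + v)| ^+ 2)) => [|v vV]; last first.
    by rewrite h_coset.
  by rewrite lerDl sumr_ge0 // => v _; rewrite exprn_ge0.
rewrite -mulr_natl ler_pM2l ?ltr0n // => /le_trans; apply.
by rewrite lerBlDr lerDl ler0n.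
Qed.

Lemma norm_sum_affine_character (R : realType) (F : finFieldType)
    (L : fieldExtType F) (chi : finvect_type L -> R[i]) (t : nat)
    (A : {set finvect_type L}) :
  multiplicative_character chi -> ~ trivial_character chi ->
  affine_space t A ->
  `|\sum_(y in A) chi y| <=
    (#|F|%:R `^ Num.min t%:R ((\dim {:L})%:R / 2))%:C.
Proof.
move=> chi_char chi_nontriv [u [V [dimV ->]]].
rewrite big_imset /=; last by move=> x y _ _ /addrI.
have cardV : #|V| = (#|F| ^ t)%N by rewrite card_vspace dimV.
have cardL : #|finvect_type L| = (#|F| ^ \dim {:L})%N.
  by have := card_vspace {: finvect_type L}; rewrite card_vspacef.
(* If the minimum is [t], the triangle inequality suffices, each term having norm at most 1.
   Otherwise both sides are squared, so that [q^(n/2)] becomes the cardinality of the field. *)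
rewrite minEle; case: ifP => _.
  rewrite powR_mulrn ?ler0n // -natrX -cardV rmorph_nat.
  apply: le_trans (ler_norm_sum _ _ _) _; rewrite -sumr_const.
  apply: ler_sum => v _; have [->|x0] := eqVneq (u + v) 0.
    by rewrite character0 // normr0 ler01.
  by rewrite norm_character.
rewrite -ler_sqr ?nnegrE ?normr_ge0 ?ler0c ?powR_ge0 // -[leRHS]rmorphXn /=.
rewrite -(powR_mulrn 2) ?powR_ge0 //.
rewrite -powRrM divfK ?pnatr_eq0 // powR_mulrn ?ler0n //.
rewrite -natrX -cardL rmorph_nat.
exact: norm_sum_coset_character.
Qed.

(** * Binomial sums and the final estimate *)

Lemma delta_bound (R : realType) (q n : nat) : (0 < q)%N ->
  delta R q n <= (2 ^+ n - 1) * q%:R `^ (n%:R / 2).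
Proof.
move=> q_gt0.
(* The subtracted 1 is the binomial coefficient at [i = n], which [delta] omits. *)
have -> : 2 ^+ n - 1 = \sum_(0 <= i < n) 'C(n, i)%:R :> R.
  rewrite -[2]/(1 + 1) exprDn big_ord_recr /= binn big_mkord.
  by under eq_bigr => i _ do rewrite !expr1n mulr1; rewrite !expr1n mulr1 addrK.
rewrite big_distrl /=; apply: ler_sum => i _; rewrite ler_wpM2l ?ler0n //.
by rewrite ler_powR ?ler1n // ge_min lexx orbT.
Qed.

(** Intersecting [#|D|] hyperplanes in general position leaves dimension [#|C| - #|D|]; grouping by
    this dimension and using the symmetry of binomial coefficients yields the shape of [delta]. *)
Lemma sum_nonempty_subsets (V : nmodType) (T : finType) (C : {set T})
    (g : nat -> V) :
  \sum_(D : {set T} | (D \subset C) && (D != set0)) g (#|C| - #|D|)%N =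
  \sum_(0 <= i < #|C|) g i *+ 'C(#|C|, i).
Proof.
have [C0|C_neq0] := eqVneq C set0.
  rewrite C0 cards0 big_geq // big_pred0 // => D.
  by rewrite subset0 andbN.
have [n cardC] : {n | #|C| = n.+1}.
  by exists #|C|.-1; rewrite prednK // card_gt0.
rewrite cardC big_mkord.
(* For nonempty [D] the difference is below [n.+1], so [inord] does not fall back to its default
   value. *)
rewrite (partition_big (fun D : {set T} =>
  inord (n.+1 - #|D|) : 'I_n.+1) xpredT) //=.
apply: eq_bigr => i _; have i_lt := ltn_ord i.
have <- : #|[set D : {set T} | D \subset C & #|D| == n.+1 - i]%N| = 'C(n.+1, i).
  by rewrite cards_draws cardC bin_sub // ltnW.
rewrite -sumr_const.
have cond (D : {set T}) : (D \subset C) && (D != set0) &&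
    (inord (n.+1 - #|D|) == i) = (D \subset C) && (#|D| == n.+1 - i)%N.
  have [DC|] //= := boolP (D \subset C).
  have leDC : (#|D| <= n.+1)%N by rewrite -cardC subset_leq_card.
  have [->|D0] := eqVneq D set0.
    by rewrite cards0 [RHS]eq_sym subn_eq0 leqNgt i_lt.
  have D_gt0 : (0 < #|D|)%N by rewrite card_gt0.
  rewrite -val_eqE /= inordK; last first.
    by rewrite ltn_subLR // -addn1 addnC leq_add2r.
  by apply/eqP/eqP => [<-|->]; rewrite subKn // ltnW.
apply: eq_big => [D|D]; first by rewrite cond inE.
by rewrite cond => /andP[_ /eqP ->]; rewrite subKn // ltnW.
Qed.

Theorem theorem3p1 (R : realType) (q n : nat) (F : finFieldType)
    (L : fieldExtType F) (C : {set {set finvect_type L}})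
    (chi : finvect_type L -> R[i]) :
  #|F| = q ->
  (2 <= n)%N ->
  \dim {:L} = n ->
  #|C| = n ->
  (forall A, A \in C -> affine_hyperplane A) ->
  general_position C ->
  multiplicative_character chi ->
  ~ trivial_character chi ->
  `| \sum_(y in complement_points C) chi y | <= (delta R q n)%:C /\
  delta R q n <= (2 ^+ n - 1) * q%:R `^ (n%:R / 2).
Proof.
move=> cardF _ dimL cardC; rewrite -{n}cardC in dimL *.
move=> _ genC chi_char chi_nontriv; split; last first.
  by apply: delta_bound; rewrite -cardF (ltnW (finNzRing_gt1 F)).
pose g (i : nat) : R[i] := (q%:R `^ Num.min i%:R (#|C|%:R / 2))%:C.
have -> : (delta R q #|C|)%:C = \sum_(0 <= i < #|C|) g i *+ 'C(#|C|, i).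
  rewrite rmorph_sum; apply: eq_bigr => i _ /=.
  by rewrite mulr_natl rmorphMn.
rewrite -sum_nonempty_subsets sum_inclusion_exclusion.
rewrite (bigD1 set0) ?sub0set //=.
rewrite big_set0 (eq_bigl xpredT) => [|y]; last by rewrite inE.
rewrite sum_character // mulr0 add0r.
apply: le_trans (ler_norm_sum _ _ _) _; apply: ler_sum => D /andP[DC D0].
(* The term of [D] is compared with [g] at the dimension of the intersection over [D]; its sign
   disappears in the norm. *)
rewrite normrMsign /g -cardF -dimL.
apply: norm_sum_affine_character => //; apply: genC => //.
by rewrite card_gt0 D0 dimL subset_leq_card.
Qed.
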